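(* Let $(A,\dashv_A,\vdash_A)$ and $(A^*,\dashv_{A^*},\vdash_{A^*})$ be diassociative algebras, where $A^*$ is the dual space of $A$. Let $\Delta_{\dashv_A},\Delta_{\vdash_A}:A\to A\otimes A$ be the linear duals of $\dashv_{A^*}$ and $\vdash_{A^*}$, respectively. If $(A,\dashv_A,\vdash_A,\Delta_{\dashv_A},\Delta_{\vdash_A})$ is a diassociative bialgebra, then $(A,\circ_A,\Delta)$ is a Leibniz bialgebra, where $$x\circ_A y:=x\vdash_A y-y\dashv_A x,\qquad \Delta(x):=\Delta_{\vdash_A}(x)-\sigma\Delta_{\dashv_A}(x),\qquad x,y\in A.$$
   Context: All vector spaces are finite-dimensional over a field $\mathbf{k}$ of characteristic $0$. $\sigma(u\otimes v)=v\otimes u$. For a bilinear operation $\diamond$, $L_\diamond(x)y=x\diamond y$ and $R_\diamond(y)x=x\diamond y$. The linear dual of an operation $*$ on $A^*$ is $\Delta:A\to A\otimes A$ with $\langle\Delta(x),a^*\otimes b^*\rangle=\langle x,a^* * b^*\rangle$. A diassociative algebra is a triple $(A,\dashv_A,\vdash_A)$ consisting of a vector space $A$ and two bilinear operations such that for all $x,y,z\in A$ (subscripts omitted): $(x\dashv y)\dashv z=x\dashv(y\dashv z)=x\dashv(y\vdash z)$; $(x\vdash y)\dashv z=x\vdash(y\dashv z)$; $(x\vdash y)\vdash z=(x\dashv y)\vdash z=x\vdash(y\vdash z)$. Put $x\bullet y:=x\vdash y-x\dashv y$. A diassociative coalgebra is a triple $(A,\Delta_{\dashv},\Delta_{\vdash})$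 with linear maps $\Delta_{\dashv},\Delta_{\vdash}:A\to A\otimes A$ such that $(\mathrm{id}\otimes\Delta_{\dashv})\Delta_{\dashv}=(\mathrm{id}\otimes\Delta_{\vdash})\Delta_{\dashv}=(\Delta_{\dashv}\otimes\mathrm{id})\Delta_{\dashv}$; $(\Delta_{\vdash}\otimes\mathrm{id})\Delta_{\dashv}=(\mathrm{id}\otimes\Delta_{\dashv})\Delta_{\vdash}$; $(\Delta_{\dashv}\otimes\mathrm{id})\Delta_{\vdash}=(\Delta_{\vdash}\otimes\mathrm{id})\Delta_{\vdash}=(\mathrm{id}\otimes\Delta_{\vdash})\Delta_{\vdash}$. A diassociative bialgebra is $(A,\dashv,\vdash,\Delta_{\dashv},\Delta_{\vdash})$ such that $(A,\dashv,\vdash)$ is a diassociative algebra, $(A,\Delta_{\dashv},\Delta_{\vdash})$ is a diassociative coalgebra and, with $\Delta_{\bullet}:=\Delta_{\vdash}-\Delta_{\dashv}$, for all $x,y\in A$: (1) $\Delta_{\vdash}(x\dashv y)=(\mathrm{id}\otimes L_{\dashv}(x))\Delta_{\vdash}(y)-(R_{\bullet}(y)\otimes\mathrm{id})\Delta_{\vdash}(x)=(\mathrm{id}\otimes L_{\dashv}(x))\Delta_{\bullet}(y)+(R_{\dashv}(y)\otimes\mathrm{id})\Delta_{\vdash}(x)$; (2) $\sigma((L_{\vdash}(y)\otimes\mathrm{id})\Delta_{\vdash}(x))-(L_{\dashv}(x)\otimes\mathrm{id})\Delta_{\bullet}(y)=(L_{\dashv}(x)\otimes\mathrm{id})\Delta_{\dashv}(y)+\sigma((L_{\bullet}(y)\otimes\mathrm{id})\Delta_{\vdash}(x))=\sigma((\mathrm{id}\otimes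 R_{\dashv}(y))\Delta_{\vdash}(x))+(\mathrm{id}\otimes R_{\bullet}(x))\Delta_{\bullet}(y)$; (3) $\sigma((\mathrm{id}\otimes R_{\vdash}(y))\Delta_{\vdash}(x))-(\mathrm{id}\otimes R_{\bullet}(x))\Delta_{\dashv}(y)=(\mathrm{id}\otimes R_{\dashv}(x))\Delta_{\dashv}(y)+\sigma((\mathrm{id}\otimes R_{\vdash}(y))\Delta_{\bullet}(x))=(L_{\vdash}(x)\otimes\mathrm{id})\Delta_{\dashv}(y)+\sigma((L_{\bullet}(y)\otimes\mathrm{id})\Delta_{\bullet}(x))$; (4) $\Delta_{\dashv}(x\vdash y)=(\mathrm{id}\otimes L_{\vdash}(x))\Delta_{\dashv}(y)-(R_{\vdash}(y)\otimes\mathrm{id})\Delta_{\bullet}(x)=(\mathrm{id}\otimes L_{\bullet}(x))\Delta_{\dashv}(y)+(R_{\vdash}(y)\otimes\mathrm{id})\Delta_{\dashv}(x)$; (5) $\Delta_{\dashv}(x\dashv y)=(R_{\dashv}(y)\otimes\mathrm{id})\Delta_{\dashv}(x)-(\mathrm{id}\otimes L_{\bullet}(x))\Delta_{\bullet}(y)$; (6) $\Delta_{\vdash}(x\vdash y)=(\mathrm{id}\otimes L_{\vdash}(x))\Delta_{\vdash}(y)-(R_{\bullet}(y)\otimes\mathrm{id})\Delta_{\bullet}(x)$. A (left) Leibniz algebra is $(A,\circ_A)$ with $x\circ_A(y\circ_A z)=(x\circ_A y)\circ_A z+y\circ_A(x\circ_A z)$ for all $x,y,z$. A Leibniz bialgebra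 is a triple $(A,\circ_A,\Delta)$ where $(A,\circ_A)$ is a Leibniz algebra, $\Delta:A\to A\otimes A$ is the linear dual of a Leibniz algebra operation $\circ_{A^*}$ on $A^*$, and for all $x,y\in A$: $\sigma((R_{\circ_A}(y)\otimes\mathrm{id})\Delta(x))=(R_{\circ_A}(x)\otimes\mathrm{id})\Delta(y)$ and $\Delta(x\circ_A y)=(\mathrm{id}\otimes R_{\circ_A}(y)-L_{\circ_A}(y)\otimes\mathrm{id}-R_{\circ_A}(y)\otimes\mathrm{id})(\mathrm{id}+\sigma)\Delta(x)+(\mathrm{id}\otimes L_{\circ_A}(x)+L_{\circ_A}(x)\otimes\mathrm{id})\Delta(y)$. *)

(* Defs.v *)
From HB Require Import structures.
From mathcomp Require Import all_boot all_algebra.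

Set Implicit Arguments.
Unset Strict Implicit.
Unset Printing Implicit Defensive.

Import GRing.Theory.
Local Open Scope ring_scope.

Reserved Notation "V \ox W" (at level 40, left associativity).
Reserved Notation "v \ot w" (at level 40, left associativity).

Notation dual V := 'Hom(V, _^o).

(* V (x) W is modelled by the bilinear forms on V^* x W^*, which is legitimate
   because all spaces are finite-dimensional; tlift_pure and tlift_unique below
   are its universal property, and everything else is defined through tlift. *)
Definition tens (k : fieldType) (V W : vectType k) : vectType k :=
  'Hom(dual V, dual (dual W)).

Notation "V \ox W" := (tens V W) : type_scope.

Section Tensor.
Variable k : fieldType.
Implicit Types U V W X : vectType k.

(* < t , a (x) b > *)
Definition tpair V W (t : V \ox W) (a : dual V) (b : dual W) : k := t a b.

Definition pure V W (v : V) (w : W) : V \ox W :=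
  linfun (fun a : dual V => linfun (fun b : dual W =>
    a v * b w : k^o)).

Definition dbasis V (i : 'I_(\dim {:V})) : dual V :=
  linfun (coord (vbasis {:V}) i : V -> k^o).

(* The linear map V (x) W -> U induced by a bilinear f : V -> W -> U. *)
Definition tlift_fun V W U (f : V -> W -> U) (t : V \ox W) : U :=
  \sum_i \sum_j
    tpair t (dbasis i) (dbasis j) *: f (vbasis {:V})`_i (vbasis {:W})`_j.

Definition tlift V W U (f : V -> W -> U) : 'Hom(V \ox W, U) :=
  linfun (tlift_fun f).

Definition tmap V V' W W' (f : 'Hom(V, V')) (g : 'Hom(W, W')) :
    'Hom(V \ox W, V' \ox W') :=
  tlift (fun v w => pure (f v) (g w)).

Definition tswap V W : 'Hom(V \ox W, W \ox V) := tlift (fun v w => pure w v).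

Definition tassoc U V W : 'Hom((U \ox V) \ox W, U \ox (V \ox W)) :=
  tlift (fun (t : U \ox V) w => tlift (fun u v => pure u (pure v w)) t).

End Tensor.

Arguments tswap {k V W}.
Arguments tassoc {k U V W}.

Notation "v \ot w" := (pure v w) : ring_scope.
Notation "f \ox g" := (tmap f g) : lfun_scope.

Section TensorTheory.
Variable k : fieldType.
Implicit Types U V W X : vectType k.

Local Notation bilinear_map f := (bilinear_for *:%R *:%R f).

Lemma linfunE V W (f : V -> W) : linear f -> linfun f =1 f.
Proof.
move=> lf v; pose m := GRing.isLinear.Build k V W *:%R f lf.
pose F : {linear V -> W} := HB.pack f m.
exact: (lfunE F).
Qed.

Lemma tens_ext V W (t t' : V \ox W) :
  (forall a b, tpair t a b = tpair t' a b) -> t = t'.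
Proof. by move=> e; apply/lfunP => a; apply/lfunP => b; apply: e. Qed.

Lemma tpair_linear V W a b :
  linear (fun t : V \ox W => tpair t a b : k^o).
Proof.
move=> c t u.
have add2 (f g : 'Hom(dual V, dual (dual W))) :
    (c *: f + g) a b = c *: f a b + g a b by rewrite !lfun_simp.
exact: add2.
Qed.

Lemma tpair_pure V W (v : V) (w : W) (a : dual V) (b : dual W) :
  tpair (v \ot w) a b = a v * b w.
Proof.
have lin2 c : linear (fun b : dual W => c * b w : k^o).
  by move=> d b1 b2; rewrite !lfun_simp mulrDr -scalerAr.
rewrite /tpair /pure linfunE; first by rewrite (linfunE (lin2 _)).
move=> c a1 a2; apply/lfunP => b'.
rewrite [RHS]add_lfunE [in RHS]scale_lfunE !(linfunE (lin2 _)).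
by rewrite add_lfunE scale_lfunE mulrDl -scalerAl.
Qed.

Lemma pure_bilinear V W : bilinear_map (@pure k V W).
Proof.
split=> [w|v] c x y; apply: tens_ext => a b; rewrite (tpair_linear a b c);
  rewrite !tpair_pure linearP.
  by rewrite mulrDl -scalerAl.
by rewrite mulrDr -scalerAr.
Qed.

HB.instance Definition _ V W :=
  bilinear_isBilinear.Build k V W (V \ox W) *:%R *:%R (@pure k V W)
    (@pure_bilinear V W).

Lemma tlift_fun_linear V W U (f : V -> W -> U) : linear (tlift_fun f).
Proof.
move=> c t u; rewrite /tlift_fun scaler_sumr -big_split; apply: eq_bigr => i _.
rewrite scaler_sumr -big_split; apply: eq_bigr => j _.
by rewrite tpair_linear scalerDl scalerA.
Qed.

Lemma tliftE V W U (f : V -> W -> U) t : tlift f t = tlift_fun f t.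
Proof. exact/linfunE/tlift_fun_linear. Qed.

Lemma dbasis_sum V (v : V) :
  v = \sum_i dbasis i v *: (vbasis {:V})`_i.
Proof.
rewrite {1}(coord_vbasis (memvf v)); apply: eq_bigr => i _.
by rewrite /dbasis lfunE.
Qed.

Lemma tlift_pure_for V W U (f : V -> W -> U) v w :
  bilinear_map f -> tlift f (v \ot w) = f v w.
Proof.
move=> bf; pose m := bilinear_isBilinear.Build k V W U *:%R *:%R f bf.
pose F : {bilinear V -> W -> U} := HB.pack f m.
rewrite tliftE /tlift_fun -[RHS]/(F v w) {2}(dbasis_sum v) {2}(dbasis_sum w).
rewrite linear_sumlz; apply: eq_bigr => i _; rewrite linear_sumr.
apply: eq_bigr => j _.
by rewrite tpair_pure linearZr_LR linearZl_LR scalerA mulrC.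
Qed.

Lemma tlift_pure V W U (f : {bilinear V -> W -> U}) v w :
  tlift f (v \ot w) = f v w.
Proof.
apply: tlift_pure_for; split=> [y|x] c a b; first by rewrite linearPl.
by rewrite linearPr.
Qed.

Lemma dual_dbasis_sum V (a : dual V) :
  a = \sum_(i < \dim {:V}) a (vbasis {:V})`_i *: dbasis i.
Proof.
apply/lfunP => v; rewrite sum_lfunE {1}(dbasis_sum v) linear_sum.
by apply: eq_bigr => i _; rewrite linearZ scale_lfunE /= [LHS]mulrC.
Qed.

Lemma tens_sum V W (t : V \ox W) :
  t = \sum_i \sum_j tpair t (dbasis i) (dbasis j) *:
        ((vbasis {:V})`_i \ot (vbasis {:W})`_j).
Proof.
apply: tens_ext => a b; pose F u : k^o := tpair u a b.
pose G : {linear V \ox W -> k^o} :=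
  HB.pack F (GRing.isLinear.Build k _ _ *:%R F (tpair_linear a b)).
rewrite -[RHS]/(G _) linear_sum.
rewrite {1}/tpair {1}(dual_dbasis_sum a) linear_sum sum_lfunE.
apply: eq_bigr => i _; rewrite linear_sum {1}(dual_dbasis_sum b) linear_sum.
apply: eq_bigr => j _; rewrite !linearZ /= scale_lfunE.
rewrite [F _]tpair_pure /tpair /GRing.scale /=.
by rewrite mulrCA [RHS]mulrC mulrA.
Qed.

Lemma tlift_unique V W U (f g : 'Hom(V \ox W, U)) :
  (forall v w, f (v \ot w) = g (v \ot w)) -> f = g.
Proof.
move=> e; apply/lfunP => t; rewrite (tens_sum t) !linear_sum.
apply: eq_bigr => i _; rewrite !linear_sum; apply: eq_bigr => j _.
by rewrite !linearZ /= e.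
Qed.

Lemma tmap_pure V V' W W' (f : 'Hom(V, V')) (g : 'Hom(W, W')) v w :
  (f \ox g)%VF (v \ot w) = f v \ot g w.
Proof.
apply: tlift_pure_for; split=> [y|x] c a b.
  by rewrite linearP linearPl.
by rewrite linearP linearPr.
Qed.

Lemma tswap_pure V W (v : V) (w : W) : tswap (v \ot w) = w \ot v.
Proof.
apply: tlift_pure_for; split=> [y|x] c a b; first by rewrite linearPr.
by rewrite linearPl.
Qed.

Lemma tassoc_pure U V W (u : U) (v : V) (w : W) :
  tassoc ((u \ot v) \ot w) = u \ot (v \ot w).
Proof.
rewrite /tassoc tlift_pure_for.
  apply: tlift_pure_for; split=> [y|x] c a b; first by rewrite linearPl.
  by rewrite linearPl linearPr.
split=> [y|x] c a b; first by rewrite linearP.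
rewrite !tliftE /= /tlift_fun scaler_sumr -big_split; apply: eq_bigr => i _.
rewrite scaler_sumr -big_split; apply: eq_bigr => j _.
by rewrite !linearPr scalerDr !scalerA mulrC.
Qed.

End TensorTheory.

Section Operations.
Variables (k : fieldType) (A : vectType k).
Implicit Types op dv vd : {bilinear A -> A -> A}.

Definition lmul op (x : A) : 'End(A) := linfun (op x).
Definition rmul op (y : A) : 'End(A) := linfun (applyr op y).

Lemma lmulE op x y : lmul op x y = op x y.
Proof. exact: lfunE. Qed.

Lemma rmulE op x y : rmul op y x = op x y.
Proof. exact: lfunE. Qed.

(* In the names below, dv and vd stand for the operations -| and |-. *)

Definition bullet dv vd (x y : A) : A := vd x y - dv x y.

Lemma bullet_bilinear dv vd : bilinear_for *:%R *:%R (bullet dv vd).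
Proof.
split=> [y|x] c a b; rewrite /bullet /= scalerBr.
  by rewrite (linearPl vd) (linearPl dv) opprD addrACA.
by rewrite (linearPr vd) (linearPr dv) opprD addrACA.
Qed.

HB.instance Definition _ dv vd :=
  bilinear_isBilinear.Build k A A A *:%R *:%R (bullet dv vd)
    (bullet_bilinear dv vd).

Definition leibniz_op dv vd (x y : A) : A := vd x y - dv y x.

Lemma leibniz_op_bilinear dv vd : bilinear_for *:%R *:%R (leibniz_op dv vd).
Proof.
split=> [y|x] c a b; rewrite /leibniz_op /= scalerBr.
  by rewrite (linearPl vd) (linearPr dv) opprD addrACA.
by rewrite (linearPr vd) (linearPl dv) opprD addrACA.
Qed.

HB.instance Definition _ dv vd :=
  bilinear_isBilinear.Build k A A A *:%R *:%R (leibniz_op dv vd)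
    (leibniz_op_bilinear dv vd).

Record diassociative_algebra dv vd : Prop := DiassociativeAlgebra {
  diassoc_dv_dv : forall x y z, dv (dv x y) z = dv x (dv y z);
  diassoc_dv_vd : forall x y z, dv x (dv y z) = dv x (vd y z);
  diassoc_mid : forall x y z, dv (vd x y) z = vd x (dv y z);
  diassoc_vd_dv : forall x y z, vd (vd x y) z = vd (dv x y) z;
  diassoc_vd_vd : forall x y z, vd (dv x y) z = vd x (vd y z)
}.

Definition leibniz_algebra op : Prop :=
  forall x y z, op x (op y z) = op (op x y) z + op y (op x z).

End Operations.

Section Bialgebras.
Variables (k : fieldType) (A : vectType k).
Implicit Types (op dv vd : {bilinear A -> A -> A}).
Implicit Types (D Ddv Dvd : 'Hom(A, A \ox A)).

Definition linear_dual (ops : {bilinear dual A -> dual A -> dual A}) D : Prop :=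
  forall (x : A) (a b : dual A),
    tpair (D x) a b = ops a b x.

Local Notation id := (\1%VF : 'End(A)).
Local Notation s := (tswap : 'Hom(A \ox A, A \ox A)).
Local Notation as3 := (tassoc : 'Hom((A \ox A) \ox A, A \ox (A \ox A))).

Local Open Scope lfun_scope.

Record diassociative_coalgebra Ddv Dvd : Prop := DiassociativeCoalgebra {
  codiassoc_dv_vd : (id \ox Ddv) \o Ddv = (id \ox Dvd) \o Ddv;
  codiassoc_dv_dv : (id \ox Dvd) \o Ddv = as3 \o (Ddv \ox id) \o Ddv;
  codiassoc_mid : as3 \o (Dvd \ox id) \o Ddv = (id \ox Ddv) \o Dvd;
  codiassoc_vd_dv :
    as3 \o (Ddv \ox id) \o Dvd = as3 \o (Dvd \ox id) \o Dvd;
  codiassoc_vd_vd : as3 \o (Dvd \ox id) \o Dvd = (id \ox Dvd) \o Dvd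
}.

Section Compatibility.
Variables (dv vd : {bilinear A -> A -> A}) (Ddv Dvd : 'Hom(A, (A \ox A)%type)).

Local Notation Ldv := (lmul dv).
Local Notation Rdv := (rmul dv).
Local Notation Lvd := (lmul vd).
Local Notation Rvd := (rmul vd).
Local Notation Lbu := (lmul (bullet dv vd)).
Local Notation Rbu := (rmul (bullet dv vd)).
Local Notation Dbu := (Dvd - Ddv).

Definition dibialg_vd_of_dv : Prop := forall x y : A,
  Dvd (dv x y) = (id \ox Ldv x) (Dvd y) - (Rbu y \ox id) (Dvd x)
  /\ (id \ox Ldv x) (Dvd y) - (Rbu y \ox id) (Dvd x)
     = (id \ox Ldv x) (Dbu y) + (Rdv y \ox id) (Dvd x).

Definition dibialg_left : Prop := forall x y : A,
  s ((Lvd y \ox id) (Dvd x)) - (Ldv x \ox id) (Dbu y)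
  = (Ldv x \ox id) (Ddv y) + s ((Lbu y \ox id) (Dvd x))
  /\ (Ldv x \ox id) (Ddv y) + s ((Lbu y \ox id) (Dvd x))
     = s ((id \ox Rdv y) (Dvd x)) + (id \ox Rbu x) (Dbu y).

Definition dibialg_right : Prop := forall x y : A,
  s ((id \ox Rvd y) (Dvd x)) - (id \ox Rbu x) (Ddv y)
  = (id \ox Rdv x) (Ddv y) + s ((id \ox Rvd y) (Dbu x))
  /\ (id \ox Rdv x) (Ddv y) + s ((id \ox Rvd y) (Dbu x))
     = (Lvd x \ox id) (Ddv y) + s ((Lbu y \ox id) (Dbu x)).

Definition dibialg_dv_of_vd : Prop := forall x y : A,
  Ddv (vd x y) = (id \ox Lvd x) (Ddv y) - (Rvd y \ox id) (Dbu x)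
  /\ (id \ox Lvd x) (Ddv y) - (Rvd y \ox id) (Dbu x)
     = (id \ox Lbu x) (Ddv y) + (Rvd y \ox id) (Ddv x).

Definition dibialg_dv_of_dv : Prop := forall x y : A,
  Ddv (dv x y) = (Rdv y \ox id) (Ddv x) - (id \ox Lbu x) (Dbu y).

Definition dibialg_vd_of_vd : Prop := forall x y : A,
  Dvd (vd x y) = (id \ox Lvd x) (Dvd y) - (Rbu y \ox id) (Dbu x).

Record diassociative_bialgebra : Prop := DiassociativeBialgebra {
  dibialg_algebra : diassociative_algebra dv vd;
  dibialg_coalgebra : diassociative_coalgebra Ddv Dvd;
  dibialg_compat1 : dibialg_vd_of_dv;
  dibialg_compat2 : dibialg_left;
  dibialg_compat3 : dibialg_right;
  dibialg_compat4 : dibialg_dv_of_vd;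
  dibialg_compat5 : dibialg_dv_of_dv;
  dibialg_compat6 : dibialg_vd_of_vd
}.

End Compatibility.

Record leibniz_bialgebra op D : Prop := LeibnizBialgebra {
  leibniz_bialg_algebra : leibniz_algebra op;
  leibniz_bialg_dual : exists2 ops : {bilinear dual A -> dual A -> dual A},
    leibniz_algebra ops & linear_dual ops D;
  leibniz_bialg_sym : forall x y : A,
    s ((rmul op y \ox id) (D x)) = (rmul op x \ox id) (D y);
  leibniz_bialg_compat : forall x y : A,
    D (op x y) =
      (id \ox rmul op y - lmul op y \ox id - rmul op y \ox id)
        ((\1 + s) (D x))
      + (id \ox lmul op x + lmul op x \ox id) (D y)
}.

End Bialgebras.

(* Main.v *)
Require Import Defs.
From HB Require Import structures.
From mathcomp Require Import all_boot all_algebra.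
From mathcomp Require Import ring.

Set Implicit Arguments.
Unset Strict Implicit.
Unset Printing Implicit Defensive.

Import GRing.Theory.
Local Open Scope ring_scope.

(** Write [P], [Q] for the coproducts dual to [|-], [-|], [s] for the swap, and
    [f_1], [f_2] for an operator acting on the first or second tensor factor.
    Cancelling common terms in the first two members of (2) and (3), and in the
    last two of (1), leaves three exchange relations:
    - [L-|(x)_2 Q y = R|-(y)_1 P x] from (1);
    - [s L-|(y)_1 P x = L-|(x)_1 P y] from (2);
    - [s R|-(y)_2 Q x = R|-(x)_2 Q y] from (3).
    They already give the symmetry condition of a Leibniz bialgebra.  Expanding
    the coproduct of [x |- y - y -| x] by (1), (4), (5) and (6), what remains
    of the compatibility condition is a combination of the first two relations
    and of the second equalities of (2) and (3). *)

(** Lets [ring] use a linear relation [w = z]: the second premise is an identity in free atoms. *)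
Lemma eq_of_subr_eq (V : zmodType) (u v w z : V) :
  w = z -> u - v = w - z -> u = v.
Proof. by move=> ->; rewrite subrr => /eqP; rewrite subr_eq0 => /eqP. Qed.

Section TensorMaps.
Variable k : fieldType.
Implicit Types U V W : vectType k.

Lemma sub_lfunE V W (f g : 'Hom(V, W)) v : (f - g) v = f v - g v.
Proof. by rewrite add_lfunE opp_lfunE. Qed.

Lemma lfunN V W (f : 'Hom(V, W)) u : f (- u) = - f u.
Proof. exact: linearN. Qed.

Lemma lfunD V W (f : 'Hom(V, W)) u v : f (u + v) = f u + f v.
Proof. exact: linearD. Qed.

Lemma tmapBl V V' W W' (f g : 'Hom(V, V')) (h : 'Hom(W, W')) :
  ((f - g) \ox h = f \ox h - g \ox h)%VF.
Proof.
apply: tlift_unique => v w.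
by rewrite sub_lfunE !tmap_pure sub_lfunE linearBl.
Qed.

Lemma tmapBr V V' W W' (f : 'Hom(V, V')) (g h : 'Hom(W, W')) :
  (f \ox (g - h) = f \ox g - f \ox h)%VF.
Proof.
apply: tlift_unique => v w.
by rewrite sub_lfunE !tmap_pure sub_lfunE linearBr.
Qed.

Lemma tswap_tmap V V' W W' (f : 'Hom(V, V')) (g : 'Hom(W, W')) t :
  tswap ((f \ox g)%VF t) = (g \ox f)%VF (tswap t).
Proof.
rewrite -!comp_lfunE; congr (fun_of_lfun _ t); apply: tlift_unique => v w.
by rewrite !comp_lfunE tmap_pure !tswap_pure tmap_pure.
Qed.

Lemma tswapK V W : cancel (@tswap k V W) tswap.
Proof.
move=> t; rewrite -comp_lfunE -[RHS]id_lfunE; congr (fun_of_lfun _ t).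
by apply: tlift_unique => v w; rewrite comp_lfunE !tswap_pure id_lfunE.
Qed.

Lemma tpair_tswap V W (t : V \ox W) a b : tpair (tswap t) b a = tpair t a b.
Proof.
(* Both pairings are made into linear forms, so that pure tensors suffice. *)
pose F u : k^o := tpair (tswap u) b a; pose G u : k^o := tpair u a b.
have lF : linear F by move=> c u v; rewrite /F linearP; apply: tpair_linear.
have lG : linear G by move=> c u v; apply: tpair_linear.
suff /lfunP/(_ t) : linfun F = linfun G by rewrite (linfunE lF) (linfunE lG).
apply: tlift_unique => v w; rewrite (linfunE lF) (linfunE lG).
by rewrite /F /G tswap_pure !tpair_pure mulrC.
Qed.

Lemma tpairN V W (t : V \ox W) a b : tpair (- t) a b = - tpair t a b.
Proof. by rewrite /tpair !opp_lfunE. Qed.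

Lemma tpairD V W (t u : V \ox W) a b :
  tpair (t + u) a b = tpair t a b + tpair u a b.
Proof. by rewrite /tpair !add_lfunE. Qed.

End TensorMaps.

Section LeibnizOfDiassociative.
Variables (k : fieldType) (A : vectType k).
Implicit Types dv vd : {bilinear A -> A -> A}.

(** The axioms bring each triple product to a right-nested form [vd _ (vd _ _)], [vd _ (dv _ _)] or
    [dv _ (dv _ _)]; on the right, the terms [vd y (vd x z)] and [dv z (dv x y)] then cancel. *)
Lemma leibniz_of_diassociative dv vd :
  diassociative_algebra dv vd -> leibniz_algebra (leibniz_op dv vd).
Proof.
case=> dd dvd mid vddv vdvd x y z; rewrite /= /leibniz_op !linearBl !linearBr /=.
rewrite !vddv !vdvd !mid !dd -!dvd.
rewrite !opprB [RHS]addrACA !subrKA [RHS]addrACA [LHS]addrACA.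
by rewrite [- vd y _ + _]addrC.
Qed.

Lemma lmul_bullet dv vd x : lmul (bullet dv vd) x = lmul vd x - lmul dv x.
Proof. by apply/lfunP => y; rewrite sub_lfunE !lmulE. Qed.

Lemma rmul_bullet dv vd x : rmul (bullet dv vd) x = rmul vd x - rmul dv x.
Proof. by apply/lfunP => y; rewrite sub_lfunE !rmulE. Qed.

Lemma lmul_leibniz dv vd x : lmul (leibniz_op dv vd) x = lmul vd x - rmul dv x.
Proof. by apply/lfunP => y; rewrite sub_lfunE !lmulE rmulE. Qed.

Lemma rmul_leibniz dv vd x : rmul (leibniz_op dv vd) x = rmul vd x - lmul dv x.
Proof. by apply/lfunP => y; rewrite sub_lfunE !rmulE lmulE. Qed.

End LeibnizOfDiassociative.

Section LeibnizOfDiassociativeBialgebra.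
Variables (k : fieldType) (A : vectType k).
Variables (dv vd : {bilinear A -> A -> A}) (Ddv Dvd : 'Hom(A, A \ox A)).

(** Normal form: operators are split into multiplications by [dv] and [vd], swaps move inward onto
    the coproducts, and pairings distribute over sums. A tensor equation paired with [a] and [b]
    thus becomes a linear identity in [k]. *)
Definition tensorE := (lmul_bullet, rmul_bullet, lmul_leibniz, rmul_leibniz,
  @tmapBl, @tmapBr, @opp_lfunE, @add_lfunE, @comp_lfunE, @id_lfunE,
  @lfunN, @lfunD, @tswap_tmap, @tswapK, @tpairN, @tpairD).

Lemma vd_of_dv_swap x y : dibialg_vd_of_dv dv vd Ddv Dvd ->
  (\1 \ox lmul dv x)%VF (Ddv y) = (rmul vd y \ox \1)%VF (Dvd x).
Proof.
move=> /(_ x y)[_ E]; apply: tens_ext => a b.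
move: E => /(congr1 (fun t => tpair t a b)); rewrite !tensorE => E.
by apply: (eq_of_subr_eq E); ring.
Qed.

Lemma left_swap x y : dibialg_left dv vd Ddv Dvd ->
  tswap ((lmul dv y \ox \1)%VF (Dvd x)) = (lmul dv x \ox \1)%VF (Dvd y).
Proof.
move=> /(_ x y)[E _]; apply: tens_ext => a b.
move: E => /(congr1 (fun t => tpair t a b)); rewrite !tensorE => E.
by apply: (eq_of_subr_eq E); ring.
Qed.

Lemma right_swap x y : dibialg_right dv vd Ddv Dvd ->
  tswap ((\1 \ox rmul vd y)%VF (Ddv x)) = (\1 \ox rmul vd x)%VF (Ddv y).
Proof.
move=> /(_ x y)[E _]; apply: tens_ext => a b.
move: E => /(congr1 (fun t => tpair t a b)); rewrite !tensorE => E.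
by apply: (eq_of_subr_eq E); ring.
Qed.

Lemma leibniz_sym x y : diassociative_bialgebra dv vd Ddv Dvd ->
  tswap ((rmul (leibniz_op dv vd) y \ox \1)%VF ((Dvd - (tswap \o Ddv))%VF x))
  = (rmul (leibniz_op dv vd) x \ox \1)%VF ((Dvd - (tswap \o Ddv))%VF y).
Proof.
case=> [_ _ c1 c2 c3 _ _ _].
(* Each side of the goal expands into four terms, matched one to one by these relations. *)
have E1 := vd_of_dv_swap y x c1.
have E2 := congr1 tswap (vd_of_dv_swap x y c1).
have E3 := left_swap x y c2; have E4 := right_swap y x c3.
move: E1 E2 E3 E4; rewrite !tensorE => E1 E2 E3 E4.
apply: tens_ext => a b; rewrite !tensorE E1 E2 E3 E4; ring.
Qed.

Lemma leibniz_compat x y : diassociative_bialgebra dv vd Ddv Dvd ->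
  let op : {bilinear A -> A -> A} := leibniz_op dv vd in
  let D := (Dvd - (tswap \o Ddv))%VF in
  D (op x y) =
    (\1 \ox rmul op y - lmul op y \ox \1 - rmul op y \ox \1)%VF
      ((\1 + tswap)%VF (D x))
    + (\1 \ox lmul op x + lmul op x \ox \1)%VF (D y).
Proof.
case=> [_ _ c1 c2 c3 c4 c5 c6] op D.
have -> : op x y = vd x y - dv y x by [].
rewrite {}/op {}/D.
have E1 := vd_of_dv_swap y x c1; have E2 := left_swap x y c2.
have [_ E3] := c3 x y; have [_ E4] := c2 y x.
have [E5 _] := c1 y x; have [E6 _] := c4 x y.
have E7 := c5 y x; have E8 := c6 x y.
apply: tens_ext => a b.
rewrite !tensorE E5 E6 E7 E8.
have {}E1 := congr1 (fun t => tpair t a b) E1.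
have {}E2 := congr1 (fun t => tpair t a b) E2.
(* After a swap, the coproducts of [y] occur only as [Dvd y] and [tswap (Ddv y)], as they do in the
   goal. *)
have {}E3 := congr1 (fun t => tpair (tswap t) a b) E3.
have {}E4 := congr1 (fun t => tpair (tswap t) a b) E4.
move: E1 E2 E3 E4; rewrite !tensorE => -> -> E3 E4.
by apply: (eq_of_subr_eq (esym (congr2 +%R E3 E4))); ring.
Qed.

End LeibnizOfDiassociativeBialgebra.

Theorem theorem5p9 (k : fieldType) (char0 : [pchar k] =i pred0)
    (A : vectType k)
    (dvA vdA : {bilinear A -> A -> A})
    (dvAs vdAs : {bilinear dual A -> dual A -> dual A})
    (Ddv Dvd : 'Hom(A, A \ox A)) :
  diassociative_algebra dvA vdA ->
  diassociative_algebra dvAs vdAs ->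
  linear_dual dvAs Ddv ->
  linear_dual vdAs Dvd ->
  diassociative_bialgebra dvA vdA Ddv Dvd ->
  leibniz_bialgebra (leibniz_op dvA vdA) (Dvd - (tswap \o Ddv))%VF.
Proof.
move=> dA dAs dualdv dualvd H; split.
- exact: leibniz_of_diassociative.
(* The swap in the coproduct is dual to the exchange of arguments in [leibniz_op]. *)
- exists (leibniz_op dvAs vdAs); first exact: leibniz_of_diassociative.
  by move=> x a b; rewrite !tensorE tpair_tswap dualdv dualvd.
- by move=> x y; apply: leibniz_sym H.
- by move=> x y; apply: leibniz_compat H.
Qed.
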